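(* Let $n\ge 2$ and let $X$ be a random vector in $\mathbb{C}^n$ which is in isotropic position and is $K$-concentrated with constants $C_0,C_0'>0$. Then there are constants $C,C'>0$, depending only on $C_0,C_0'$, such that for any nonzero matrix $A\in\mathbb{C}^{n\times n}$ and any $t>0$, $$\mathbf{P}(|X^*AX-\operatorname{trace}(A)|\ge t)\le C\log n\,\exp\left(-C'K^{-2}\min\left\{\frac{t^2}{\|A\|_F^2\log n},\frac{t}{\|A\|_2}\right\}\right).$$
   Context: $\|A\|_F$ and $\|A\|_2$ denote the Frobenius norm and the spectral (operator) norm of $A$. A random vector $X$ in $\mathbb{C}^n$ is in isotropic position if $\mathbf{E}\,XX^*=\mathrm{Id}$ (the $n\times n$ identity matrix). Let $K>0$ (possibly depending on $n$). A random vector $X$ in $\mathbb{C}^n$ is $K$-concentrated, with constants $C_0,C_0'>0$ (not depending on $n$), if for every convex function $F:\mathbb{C}^n\to\mathbb{R}$ that is $1$-Lipschitz with respect to the Euclidean norm and every $t>0$, $$\mathbf{P}(|F(X)-M(F(X))|\ge t)\le C_0\exp\left(-C_0'\frac{t^2}{K^2}\right),$$ where $M(Y)$ denotes a median of the real random variable $Y$ (chosen arbitrarily if there are several). *)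

(* Defs.v *)
From HB Require Import structures.
From mathcomp Require Import all_boot all_order all_algebra.
From mathcomp Require Import all_classical all_reals all_analysis.
From mathcomp Require Import complex.

Set Implicit Arguments.
Unset Strict Implicit.
Unset Printing Implicit Defensive.

Import Order.TTheory GRing.Theory Num.Theory.

Local Open Scope classical_set_scope.
Local Open Scope ring_scope.
Local Open Scope sesquilinear_scope.
Local Open Scope complex_scope.

Section Norms.
Variables (R : realType) (m n : nat).

(* [ComplexField.Normc.normc] is the R-valued modulus; the norm [`|z|] of
   R[i] takes its values in R[i]. *)
Definition cmod (z : R[i]) : R := ComplexField.Normc.normc z.

Definition euclidean_norm (x : 'cV[R[i]]_n) : R :=
  Num.sqrt (\sum_(i < n) cmod (x i 0) ^+ 2).

Definition frobenius_norm (A : 'M[R[i]]_(m, n)) : R :=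
  Num.sqrt (\sum_(i < m) \sum_(j < n) cmod (A i j) ^+ 2).

End Norms.

Definition operator_norm (R : realType) (m n : nat) (A : 'M[R[i]]_(m, n)) : R :=
  sup [set euclidean_norm (A *m x) | x in [set x | euclidean_norm x <= 1]].

Section FunctionsOnCn.
Variables (R : realType) (n : nat).

(* Convexity over the real vector space underlying C^n.  The library's
   [convex_function] does not apply, as 'cV[R[i]]_n is a module over R[i]
   and not over R. *)
Definition convex_on_Cn (F : 'cV[R[i]]_n -> R) : Prop :=
  forall (s : R) (x y : 'cV[R[i]]_n), 0 <= s <= 1 ->
    F (s%:C *: x + (1 - s)%:C *: y) <= s * F x + (1 - s) * F y.

(* The library's [lipschitz] would use the sup norm on matrices. *)
Definition one_lipschitz (F : 'cV[R[i]]_n -> R) : Prop :=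
  forall x y : 'cV[R[i]]_n, `|F x - F y| <= euclidean_norm (x - y).

End FunctionsOnCn.

Section Probability.
Variables (R : realType) (d : measure_display) (T : measurableType d).
Variable P : probability T R.

Definition is_median (Y : T -> R) (m : R) : Prop :=
  ((1 / 2)%:E <= P [set w | (Y w <= m)%R])%E /\
  ((1 / 2)%:E <= P [set w | (m <= Y w)%R])%E.

Definition complex_integrable (Z : T -> R[i]) : Prop :=
  P.-integrable [set: T] (fun w => (complex.Re (Z w))%:E) /\
  P.-integrable [set: T] (fun w => (complex.Im (Z w))%:E).

(* Meaningful only if [complex_integrable Z]. *)
Definition complex_expectation (Z : T -> R[i]) : R[i] :=
  fine ('E_P[fun w => complex.Re (Z w)])%E
    +i* fine ('E_P[fun w => complex.Im (Z w)])%E.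

Variable n : nat.

(* R[i] carries no measurable structure in the library; Borel measurability
   into C^n = R^(2n) is measurability of all real coordinates. *)
Definition random_vector (X : T -> 'cV[R[i]]_n) : Prop :=
  forall i : 'I_n,
    measurable_fun [set: T] (fun w => complex.Re (X w i 0)) /\
    measurable_fun [set: T] (fun w => complex.Im (X w i 0)).

Definition isotropic (X : T -> 'cV[R[i]]_n) : Prop :=
  (forall i j : 'I_n,
     complex_integrable (fun w => (X w *m (X w)^t*) i j)) /\
  \matrix_(i < n, j < n)
     complex_expectation (fun w => (X w *m (X w)^t*) i j) = 1%:M.

(* Medians are chosen arbitrarily: for each F, some median m of F(X) is used,
   the same one for all t. *)
Definition concentrated (C0 C0' K : R) (X : T -> 'cV[R[i]]_n) : Prop :=
  forall F : 'cV[R[i]]_n -> R, convex_on_Cn F -> one_lipschitz F ->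
  exists m : R, is_median (fun w => F (X w)) m /\
    forall t : R, 0 < t ->
      (P [set w | (t <= `|F (X w) - m|)%R]
         <= (C0 * expR (- (C0' * (t ^+ 2 / K ^+ 2))))%:E)%E.

End Probability.

(* Main.v *)
Require Import Defs.
From HB Require Import structures.
From mathcomp Require Import all_boot all_order all_algebra.
From mathcomp Require Import all_classical all_reals all_analysis.
From mathcomp Require Import measurable_realfun complex ring lra.

Set Implicit Arguments.
Unset Strict Implicit.
Unset Printing Implicit Defensive.

Import Order.TTheory GRing.Theory Num.Theory.

Local Open Scope classical_set_scope.
Local Open Scope ring_scope.
Local Open Scope sesquilinear_scope.
Local Open Scope complex_scope.

(** A quadratic form is easy to control when it is a square: if B is a
contraction then x |-> ||B x|| is convex and 1-Lipschitz, so it concentrates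
about a median M at scale K.  Isotropy gives E ||B X||^2 = ||B||_F^2, and
integrating the tail shows that M lies within O(K) of ||B||_F
([rms_near_center]).  Since y^2 - mu^2 = (y - mu)(y + mu), the square ||B X||^2
then deviates from ||B||_F^2 by s with probability at most
C exp(- c K^-2 m) as soon as m ||B||_F^2 <= s^2 and m <= s
([contraction_concentration]).  With B = diag(sqrt a) U, U unitary and
0 <= a_i <= 1, this is a tail bound for sum_i a_i |(U x)_i|^2 whose Gaussian
part sees sum_i a_i.

For a general A, the real part of x^* A x is x^* H x with H the Hermitian part
of A, hence sum_i lam_i |(U x)_i|^2 by the spectral theorem
([re_quadratic_form_diagonal]); the imaginary part is the real part for - i A.
What is wanted is a Gaussian part that sees sum_i lam_i^2, and
sum_i a_i is comparable to sum_i a_i^2 only when the nonzero a_i are all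
comparable to 1.  So the positive and the negative lam_i are cut into about
log_2 n dyadic levels, |lam_i| / ||A|| being between 2^-(k+1) and 2^-k on level k;
what lies below about ||A|| / n is put in the last level, where crude bounds
suffice.  The
deviation t is shared among the levels so that no logarithm is lost in front of
||A||: a level receives a share that contains 2^-k t / 4 as well as a term
that grows with its own contribution to ||A||_F^2
([nonneg_form_concentration]).  The union bound over the levels costs the
factor log n in front of the exponential, and the sharing costs the log n that
divides t^2 / ||A||_F^2. *)

(** * Euclidean, Frobenius and operator norms of complex matrices *)

Section EuclideanNorm.
Variable R : realType.

Lemma sqr_cmod (z : R[i]) : cmod z ^+ 2 = complex.Re z ^+ 2 + complex.Im z ^+ 2.
Proof. by case: z => a b; rewrite /cmod /= sqr_sqrtr// addr_ge0// sqr_ge0. Qed.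

Lemma cmod_ge0 (z : R[i]) : 0 <= cmod z.
Proof. by case: z => a b; exact: sqrtr_ge0. Qed.

Lemma norm_Re_le_cmod (z : R[i]) : `|complex.Re z| <= cmod z.
Proof.
rewrite -(ler_pXn2r (n := 2)) ?nnegrE ?cmod_ge0// sqr_cmod real_normK ?num_real//.
by rewrite lerDl sqr_ge0.
Qed.

Lemma cmodM (z1 z2 : R[i]) : cmod (z1 * z2) = cmod z1 * cmod z2.
Proof. exact: ComplexField.Normc.normcM. Qed.

Lemma cmodJ (z : R[i]) : cmod (z^*)%R = cmod z.
Proof. by case: z => a b; rewrite /cmod/= sqrrN. Qed.

Lemma cmod_real (a : R) : 0 <= a -> cmod a%:C = a.
Proof. by move=> a0; rewrite /cmod/= expr0n addr0 sqrtr_sqr ger0_norm. Qed.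

Lemma cmod_sum_le (I : finType) (F : I -> R[i]) :
  cmod (\sum_i F i) <= \sum_i cmod (F i).
Proof.
elim/big_ind2: _ => [|x1 x2 y1 y2 h1 h2|//].
  by rewrite /cmod ComplexField.Normc.normc0.
by apply: le_trans (lerD h1 h2); exact: le_normcD.
Qed.

(** Cauchy-Schwarz, by expanding the nonnegative double sum of the
(a_i b_j - a_j b_i)^2 (Lagrange's identity). *)
Lemma sqr_sum_mul_le (I : finType) (a b : I -> R) :
  (\sum_i a i * b i) ^+ 2 <= (\sum_i a i ^+ 2) * (\sum_i b i ^+ 2).
Proof.
have : 0 <= \sum_i \sum_j (a i * b j - a j * b i) ^+ 2.
  by do 2 apply: sumr_ge0 => ? _; exact: sqr_ge0.
set A := \sum_i a i ^+ 2; set B := \sum_i b i ^+ 2; set S := \sum_i a i * b i.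
suff -> : \sum_i \sum_j (a i * b j - a j * b i) ^+ 2 = A * B + B * A - 2 * S * S.
  by lra.
rewrite {1}/A {2}/B {2}/S mulr_suml mulr_suml mulr_sumr -big_split -sumrB/=.
apply: eq_bigr => i _; rewrite /A /B /S !mulr_sumr mulr_suml -big_split -sumrB/=.
by apply: eq_bigr => j _; ring.
Qed.

Lemma euclidean_norm_ge0 n (x : 'cV[R[i]]_n) : 0 <= euclidean_norm x.
Proof. exact: sqrtr_ge0. Qed.

Lemma sqr_euclidean_norm n (x : 'cV[R[i]]_n) :
  euclidean_norm x ^+ 2 = \sum_i cmod (x i 0) ^+ 2.
Proof. by rewrite sqr_sqrtr// sumr_ge0// => i _; exact: sqr_ge0. Qed.

Lemma frobenius_norm_ge0 m n (A : 'M[R[i]]_(m, n)) : 0 <= frobenius_norm A.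
Proof. exact: sqrtr_ge0. Qed.

Lemma sqr_frobenius_norm m n (A : 'M[R[i]]_(m, n)) :
  frobenius_norm A ^+ 2 = \sum_i \sum_j cmod (A i j) ^+ 2.
Proof. by rewrite sqr_sqrtr//; do 2 apply: sumr_ge0 => ? _; exact: sqr_ge0. Qed.

Lemma euclidean_normD n (x y : 'cV[R[i]]_n) :
  euclidean_norm (x + y) <= euclidean_norm x + euclidean_norm y.
Proof.
rewrite -(ler_pXn2r (n := 2)) ?nnegrE ?addr_ge0 ?euclidean_norm_ge0//.
have cs : \sum_i cmod (x i 0) * cmod (y i 0) <= euclidean_norm x * euclidean_norm y.
  rewrite -(ler_pXn2r (n := 2)) ?nnegrE ?mulr_ge0 ?euclidean_norm_ge0 ?sumr_ge0//.
    by rewrite exprMn !sqr_euclidean_norm; exact: sqr_sum_mul_le.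
  by move=> i _; rewrite mulr_ge0 ?cmod_ge0.
rewrite sqrrD !sqr_euclidean_norm.
apply: (@le_trans _ _ (\sum_i (cmod (x i 0) + cmod (y i 0)) ^+ 2)).
  apply: ler_sum => i _; rewrite mxE ler_pXn2r ?nnegrE ?addr_ge0 ?cmod_ge0//.
  exact: le_normcD.
under eq_bigr => i _ do rewrite sqrrD -mulr_natr.
by rewrite !big_split/= -mulr_suml; lra.
Qed.

Lemma euclidean_normZ n (z : R[i]) (x : 'cV[R[i]]_n) :
  euclidean_norm (z *: x) = cmod z * euclidean_norm x.
Proof.
apply/eqP; rewrite -(eqrXn2 (n := 2)) ?mulr_ge0 ?euclidean_norm_ge0 ?cmod_ge0//.
rewrite exprMn !sqr_euclidean_norm mulr_sumr; apply/eqP/eq_bigr => i _.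
by rewrite mxE cmodM exprMn.
Qed.

Lemma euclidean_norm_mulmx_le m n (A : 'M[R[i]]_(m, n)) (x : 'cV[R[i]]_n) :
  euclidean_norm (A *m x) <= frobenius_norm A * euclidean_norm x.
Proof.
rewrite -(ler_pXn2r (n := 2)) ?nnegrE ?mulr_ge0 ?euclidean_norm_ge0
  ?frobenius_norm_ge0//.
rewrite exprMn sqr_euclidean_norm sqr_frobenius_norm mulr_suml.
apply: ler_sum => i _; rewrite sqr_euclidean_norm mxE.
apply: le_trans (sqr_sum_mul_le _ _).
rewrite ler_pXn2r ?nnegrE ?cmod_ge0 ?sumr_ge0//.
  by apply: le_trans (cmod_sum_le _) _; under eq_bigr do rewrite cmodM.
by move=> j _; rewrite mulr_ge0 ?cmod_ge0.
Qed.

Lemma cmod_le_euclidean_norm n (x : 'cV[R[i]]_n) i : cmod (x i 0) <= euclidean_norm x.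
Proof.
rewrite -(ler_pXn2r (n := 2)) ?nnegrE ?cmod_ge0 ?euclidean_norm_ge0//.
rewrite sqr_euclidean_norm (bigD1 i)//= lerDl sumr_ge0// => j _.
exact: sqr_ge0.
Qed.

(** The operator norm is a supremum, which bounds the elements of its set only
once this set is known to be bounded. *)
Lemma operator_norm_set_bounded m n (A : 'M[R[i]]_(m, n)) :
  ubound [set euclidean_norm (A *m x) | x in [set x | euclidean_norm x <= 1]]
         (frobenius_norm A).
Proof.
move=> _ [x /= x1 <-]; apply: le_trans (euclidean_norm_mulmx_le _ _) _.
by rewrite ler_piMr ?frobenius_norm_ge0.
Qed.

Lemma euclidean_norm_mulmx_le_operator_norm m n (A : 'M[R[i]]_(m, n)) x :
  euclidean_norm x <= 1 -> euclidean_norm (A *m x) <= operator_norm A.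
Proof.
move=> x1; apply: ub_le_sup; last by exists x.
by exists (frobenius_norm A); exact: operator_norm_set_bounded.
Qed.

Lemma euclidean_norm0 n : euclidean_norm (0 : 'cV[R[i]]_n) = 0.
Proof. by rewrite -[0](scale0r 0) euclidean_normZ cmod_real// mul0r. Qed.

Lemma operator_norm_ge0 m n (A : 'M[R[i]]_(m, n)) : 0 <= operator_norm A.
Proof.
apply: le_trans (euclidean_norm_ge0 (A *m 0)) _.
by apply: euclidean_norm_mulmx_le_operator_norm; rewrite euclidean_norm0.
Qed.

Lemma operator_norm_le_frobenius_norm m n (A : 'M[R[i]]_(m, n)) :
  operator_norm A <= frobenius_norm A.
Proof.
apply: ge_sup; last exact: operator_norm_set_bounded.
by exists (euclidean_norm (A *m 0)), 0 => //=; rewrite euclidean_norm0.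
Qed.

Lemma sqr_euclidean_normE n (x : 'cV[R[i]]_n) :
  (euclidean_norm x ^+ 2)%:C = (x^t* *m x) 0 0.
Proof.
rewrite sqr_euclidean_norm mxE rmorph_sum/=; apply: eq_bigr => i _.
rewrite !mxE; case: (x i 0) => a b; rewrite sqr_cmod.
by apply/eqP; rewrite eq_complex /=; apply/andP; split; apply/eqP; ring.
Qed.

Lemma euclidean_norm_unitary n (U : 'M[R[i]]_n) (x : 'cV[R[i]]_n) :
  U \is unitarymx -> euclidean_norm (U *m x) = euclidean_norm x.
Proof.
move=> uU; apply/eqP.
rewrite -(eqrXn2 (n := 2)) ?euclidean_norm_ge0//; apply/eqP/complexI.
by rewrite !sqr_euclidean_normE trmx_mul map_mxM/= mulmxA mulmxKtV.
Qed.

Lemma frobenius_norm_unitaryl n (U A : 'M[R[i]]_n) :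
  U \is unitarymx -> frobenius_norm (U *m A) = frobenius_norm A.
Proof.
move=> uU; congr (Num.sqrt _).
rewrite exchange_big [RHS]exchange_big/=; apply: eq_bigr => j _.
have := congr1 (fun r => r ^+ 2) (euclidean_norm_unitary (col j A) uU).
rewrite !sqr_euclidean_norm => e.
transitivity (\sum_i cmod ((U *m col j A) i 0) ^+ 2); last first.
  by rewrite e; apply: eq_bigr => i _; rewrite mxE.
apply: eq_bigr => i _; rewrite !mxE; congr (cmod _ ^+ 2).
by apply: eq_bigr => k _; rewrite mxE.
Qed.

Lemma frobenius_norm_adjoint m n (A : 'M[R[i]]_(m, n)) :
  frobenius_norm (A^t*) = frobenius_norm A.
Proof.
congr (Num.sqrt _); rewrite exchange_big/=; apply: eq_bigr => i _.
by apply: eq_bigr => j _; rewrite !mxE cmodJ.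
Qed.

Lemma frobenius_norm_unitaryr n (U A : 'M[R[i]]_n) :
  U \is unitarymx -> frobenius_norm (A *m U) = frobenius_norm A.
Proof.
move=> uU; rewrite -frobenius_norm_adjoint trmx_mul map_mxM/=.
by rewrite frobenius_norm_unitaryl ?trmxC_unitary// frobenius_norm_adjoint.
Qed.

(** U and lam come from the spectral decomposition of H = (A + A') / 2, where A'
is the adjoint of A.  Both bounds on lam are obtained without estimating norms
of H, because lam_i is the real part of the i-th diagonal entry of U A U'.  This
entry is a coordinate of U A v for a unit vector v, hence at most ||A||, and its
squared modulus is one of the terms of ||U A U'||_F^2 = ||A||_F^2. *)
Lemma re_quadratic_form_diagonal n (A : 'M[R[i]]_n) :
  exists (U : 'M[R[i]]_n) (lam : 'I_n -> R),
  [/\ U \is unitarymx,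
      forall x : 'cV_n, complex.Re ((x^t* *m A *m x) 0 0) =
        \sum_i lam i * cmod ((U *m x) i 0) ^+ 2,
      complex.Re (\tr A) = \sum_i lam i,
      forall i, `|lam i| <= operator_norm A &
      \sum_i lam i ^+ 2 <= frobenius_norm A ^+ 2].
Proof.
pose H : 'M[R[i]]_n := 2^-1 *: (A + A^t*).
have Hherm : H \is hermsymmx.
  apply/is_hermitianmxP; rewrite expr0 scale1r /H.
  apply/matrixP => i j; rewrite !mxE rmorphM rmorphD/= conjCK addrC.
  by congr (_ * _); rewrite fmorphV rmorph_nat.
pose U := spectralmx H; have uU : U \is unitarymx := spectral_unitarymx H.
have /mxOverP dreal := hermitian_spectral_diag_real Hherm.
pose lam i := complex.Re (spectral_diag H 0 i).
have lamE i : (lam i)%:C = spectral_diag H 0 i by exact/RRe_real/dreal.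
have quadE (x : 'cV_n) : complex.Re ((x^t* *m A *m x) 0 0) =
    \sum_i lam i * cmod ((U *m x) i 0) ^+ 2.
  have -> : complex.Re ((x^t* *m A *m x) 0 0) = complex.Re ((x^t* *m H *m x) 0 0).
    rewrite /H -scalemxAr -scalemxAl mulmxDr mulmxDl.
    have -> : x^t* *m A^t* *m x = (x^t* *m A *m x)^t*.
      by rewrite !trmx_mul !map_mxM/= trmxCK mulmxA.
    rewrite !mxE; case: (\sum_j _) => a b.
    by rewrite -[2%R](rmorph_nat (real_complex R)) -fmorphV/=; field.
  have /hermitian_normalmx/orthomx_spectralP -> := Hherm.
  rewrite invmx_unitary// -/U.
  have -> : x^t* *m (U^t* *m diag_mx (spectral_diag H) *m U) *m x =
      (U *m x)^t* *m (diag_mx (spectral_diag H) *m (U *m x)).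
    by rewrite trmx_mul map_mxM/= !mulmxA.
  rewrite mxE raddf_sum/=; apply: eq_bigr => i _.
  rewrite mul_diag_mx !mxE -lamE; case: (\sum_j _) => a b.
  by rewrite sqr_cmod/=; ring.
(* Evaluate the form at the i-th column of U^*, which U maps to the i-th basis vector. *)
have lam_diag i : lam i = complex.Re ((U *m A *m U^t*) i i).
  have /unitarymxP UU := uU.
  have Ucol j : cmod ((U *m col i (U^t*)) j 0) = (j == i)%:R.
    by rewrite colE mulmxA UU mul1mx mxE eqxx andbT; case: eqP; rewrite cmod_real.
  have := quadE (col i (U^t*)); rewrite (bigD1 i)//= big1 => [|j /negbTE ji].
    rewrite Ucol eqxx expr1n mulr1 addr0.
    move=> <-; congr complex.Re.
    have -> : (col i (U^t*))^t* = row i U.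
      by apply/matrixP => k l; rewrite !mxE conjCK.
    by rewrite -row_mul !mxE; apply: eq_bigr => k _; rewrite !mxE.
  by rewrite Ucol ji expr0n mulr0.
exists U, lam; split => //.
- under eq_bigr do rewrite lam_diag; rewrite -raddf_sum/=; congr complex.Re.
  rewrite -[LHS](_ : \tr (U *m A *m U^t*) = _)//.
  by rewrite mxtrace_mulC mulmxA -invmx_unitary// mulVmx ?mul1mx// spectral_unit.
- move=> i; rewrite lam_diag; apply: le_trans (norm_Re_le_cmod _) _.
  have -> : (U *m A *m U^t*) i i = (U *m (A *m col i (U^t*))) i 0.
    by rewrite mulmxA !mxE; apply: eq_bigr => j _; rewrite !mxE.
  apply: le_trans (cmod_le_euclidean_norm _ _) _.
  rewrite euclidean_norm_unitary//; apply: euclidean_norm_mulmx_le_operator_norm.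
  rewrite colE euclidean_norm_unitary ?trmxC_unitary//.
  rewrite -(ler_pXn2r (n := 2)) ?nnegrE ?euclidean_norm_ge0//.
  rewrite sqr_euclidean_norm (bigD1 i)//= big1 => [|j /negbTE ji].
    by rewrite mxE !eqxx cmod_real// addr0.
  by rewrite mxE ji cmod_real// expr0n.
- rewrite -(frobenius_norm_unitaryr A (U := U^t*)) ?trmxC_unitary//.
  rewrite -(frobenius_norm_unitaryl (A *m _) uU) mulmxA sqr_frobenius_norm.
  apply: ler_sum => i _; rewrite lam_diag (bigD1 i)//= -[leLHS]addr0 lerD//.
    by rewrite -real_normK ?num_real// ler_pXn2r ?nnegrE ?cmod_ge0 ?norm_Re_le_cmod.
  by apply: sumr_ge0 => j _; exact: sqr_ge0.
Qed.
End EuclideanNorm.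

(** * From a tail bound about a point to the distance to the quadratic mean *)

Section Means.
Context (d : measure_display) (T : measurableType d) (R : realType).
Variable P : probability T R.
Implicit Types (f g : T -> R).

(** The equality alone would leave out integrability, which linearity requires. *)
Definition has_mean f (m : R) : Prop :=
  P.-integrable setT (EFin \o f) /\ (\int[P]_w (f w)%:E = m%:E)%E.

Lemma has_mean_cst (c : R) : has_mean (cst c) c.
Proof.
split; first exact: finite_measure_integrable_cst.
by have := expectation_cst P c; rewrite unlock.
Qed.

Lemma has_meanD f g (a b : R) :
  has_mean f a -> has_mean g b -> has_mean (fun w => f w + g w) (a + b).
Proof.
move=> [fi fa] [gi gb]; split.
  by apply: eq_integrable (integrableD measurableT fi gi).
by rewrite EFinD -fa -gb -integralD.
Qed.

Lemma has_meanZ f (a k : R) : has_mean f a -> has_mean (fun w => k * f w) (k * a).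
Proof.
move=> [fi fa]; split.
  by apply: eq_integrable (integrableZl measurableT k fi).
by rewrite EFinM -fa -integralZl.
Qed.

Lemma has_mean_sum (I : Type) (s : seq I) (F : I -> T -> R) (a : I -> R) :
  (forall i, has_mean (F i) (a i)) ->
  has_mean (fun w => \sum_(i <- s) F i w) (\sum_(i <- s) a i).
Proof.
move=> Fa; elim: s => [|i s IHs].
  rewrite big_nil; under [X in has_mean X]eq_fun do rewrite big_nil.
  exact: has_mean_cst.
rewrite big_cons; under [X in has_mean X]eq_fun do rewrite big_cons.
exact: has_meanD.
Qed.

Lemma has_mean_le f g (a v : R) : has_mean f a -> measurable_fun setT g ->
  (forall w, 0 <= g w) -> (forall w, f w <= g w) ->
  (\int[P]_w (g w)%:E <= v%:E)%E -> a <= v.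
Proof.
move=> [fi fa] mg g0 fg gv; rewrite -lee_fin; apply: le_trans (gv); rewrite -fa.
have gi : P.-integrable setT (EFin \o g).
  apply/integrableP; split; first exact/measurable_EFinP.
  rewrite (eq_integral (EFin \o g)) => [|w _]; last by rewrite /= ger0_norm.
  by apply: le_lt_trans gv _; rewrite ltry.
by apply: le_integral => // w _; rewrite /= lee_fin.
Qed.

(** E Z^2 is the integral of P(Z^2 > r) over r > 0.  The tail hypothesis bounds
the integrand by c exp(- rate r), which is c / rate times the density of the
exponential distribution. *)
Lemma integral_sqr_le_of_tail (Z : T -> R) (c rate : R) :
  measurable_fun setT Z -> 0 <= c -> 0 < rate ->
  (forall t, 0 < t ->
    (P [set w | (t <= `|Z w|)%R] <= (c * expR (- (rate * t ^+ 2)))%:E)%E) ->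
  (\int[P]_w (Z w ^+ 2)%:E <= (c / rate)%:E)%E.
Proof.
move=> mZ c0 rate0 tail.
have mZ2 : measurable_fun setT (fun w => Z w ^+ 2) by exact: measurable_funX.
pose X : {RV P >-> R} := mfun_Sub (mem_set mZ2).
have -> : (\int[P]_w (Z w ^+ 2)%:E = 'E_P[X])%E by rewrite expectation_def.
rewrite ge0_expectation_ccdf => [|w]; last exact: sqr_ge0.
(* The tail hypothesis says nothing at r = 0, a null set. *)
rewrite -integral_itv_obnd_cbnd; last by apply: measurable_funTS; exact: ccdf_measurable.
apply: (@le_trans _ _ (\int[lebesgue_measure]_r
    ((c / rate)%:E * (exponential_pdf rate r)%:E))%E); last first.
  rewrite ge0_integralZl_EFin//.
  - by rewrite integral_exponential_pdf// mule1.
  - by move=> r _; rewrite lee_fin exponential_pdf_ge0 ?ltW.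
  - by apply/measurable_EFinP; exact: measurable_exponential_pdf.
  - exact: divr_ge0 c0 (ltW rate0).
apply: (@le_trans _ _ (\int[lebesgue_measure]_(r in `]0%R, +oo[)
    ((c / rate)%:E * (exponential_pdf rate r)%:E))%E); last first.
  apply: ge0_subset_integral => //.
    apply/measurable_EFinP; apply: measurable_funM => //.
    exact: measurable_exponential_pdf.
  by move=> r _; rewrite -EFinM lee_fin mulr_ge0 ?exponential_pdf_ge0
    ?(ltW rate0)// divr_ge0// ltW.
apply: ge0_le_integral => //.
- by apply: measurable_funTS; exact: ccdf_measurable.
- apply/measurable_funTS/measurable_EFinP; apply: measurable_funM => //.
  exact: measurable_exponential_pdf.
move=> r /=; rewrite in_itv/= andbT => r0.
rewrite exponential_pdfE ?(ltW r0)// -EFinM mulrA divfK ?gt_eqF//.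
have sr : 0 < Num.sqrt r by rewrite sqrtr_gt0.
have := tail _ sr; rewrite sqr_sqrtr ?(ltW r0)// -mulNr; apply: le_trans.
rewrite -[leLHS]/(P (X @^-1` `]r, +oo[)).
apply: le_measure; rewrite ?inE.
- by rewrite -[X in measurable X]setTI; exact: (measurable_funP X).
- rewrite -[X in measurable X]setTI; apply: measurable_fun_le => //.
  exact: measurableT_comp.
move=> w /=; rewrite in_itv/= andbT => rX.
rewrite -(ler_pXn2r (n := 2)) ?nnegrE ?sqrtr_ge0// real_normK ?num_real//.
by rewrite sqr_sqrtr ?ltW.
Qed.

(** For mu > 0 one has Y <= (Y^2 / mu + mu) / 2, so (Y - M)^2 is bounded below by
an affine function of Y^2 whose mean is (mu - M)^2.  With another constant a
in place of mu the argument still gives a lower bound, and letting a be small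
settles mu = 0. *)
Lemma rms_near_center (Y : T -> R) (mu M v : R) :
  measurable_fun setT Y -> 0 <= mu -> 0 <= M ->
  has_mean (fun w => Y w ^+ 2) (mu ^+ 2) ->
  (\int[P]_w ((Y w - M) ^+ 2)%:E <= v%:E)%E -> (mu - M) ^+ 2 <= v.
Proof.
move=> mY mu0 M0 EY vle.
have v0 : 0 <= v.
  rewrite -lee_fin; apply: le_trans (vle); apply: integral_ge0 => w _.
  by rewrite lee_fin sqr_ge0.
have key a : 0 < a -> (1 - M / a) * mu ^+ 2 + (M ^+ 2 - M * a) <= v.
  move=> a0; apply: (@has_mean_le
    (fun w => (1 - M / a) * Y w ^+ 2 + (M ^+ 2 - M * a))
    (fun w => (Y w - M) ^+ 2)) (vle).
  - exact: has_meanD (has_meanZ _ EY) (has_mean_cst _).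
  - by apply: measurable_funX; exact: measurable_funB.
  - by move=> w; exact: sqr_ge0.
  move=> w; rewrite -subr_ge0.
  have -> : (Y w - M) ^+ 2 - ((1 - M / a) * Y w ^+ 2 + (M ^+ 2 - M * a)) =
      M / a * (Y w - a) ^+ 2 by field; lra.
  by rewrite mulr_ge0 ?sqr_ge0 ?divr_ge0 ?(ltW a0).
have [mu_gt0|] := ltP 0 mu.
  have := key mu mu_gt0; apply: le_trans; rewrite le_eqVlt; apply/orP; left.
  by apply/eqP; field; lra.
rewrite le_eqVlt ltNge mu0 orbF => /eqP mu_eq0; rewrite leNgt; apply/negP => vM.
have M_gt0 : 0 < M by nra.
(* At this value of a the lower bound is (M^2 + v) / 2, which exceeds v. *)
have := key ((M ^+ 2 - v) / (2 * M)).
rewrite mu_eq0 sub0r sqrrN in vM; rewrite mu_eq0 expr0n mulr0 add0r.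
have -> : M * ((M ^+ 2 - v) / (2 * M)) = (M ^+ 2 - v) / 2 by field; lra.
by move/(_ (divr_gt0 _ _)); rewrite subr_gt0 vM mulr_gt0//; lra.
Qed.

End Means.

(** * Concentration of the squared norm of a contraction of X *)

Lemma sqr_cmod_Re (R : realType) (z : R[i]) : cmod z ^+ 2 = complex.Re (z * (z^*)%R).
Proof. by rewrite sqr_cmod; case: z => a b /=; ring. Qed.

Lemma Re_mul (R : realType) (z1 z2 : R[i]) : complex.Re (z1 * z2) =
  complex.Re z1 * complex.Re z2 - complex.Im z1 * complex.Im z2.
Proof. by case: z1 z2 => a b [c e]. Qed.

Lemma Im_mul (R : realType) (z1 z2 : R[i]) : complex.Im (z1 * z2) =
  complex.Re z1 * complex.Im z2 + complex.Im z1 * complex.Re z2.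
Proof. by case: z1 z2 => a b [c e]. Qed.

Section Contraction.
Context (d : measure_display) (T : measurableType d) (R : realType).
Variables (P : probability T R) (n : nat) (X : T -> 'cV[R[i]]_n).

Lemma random_vector_mulmx (B : 'M[R[i]]_n) :
  random_vector X -> random_vector (fun w => B *m X w).
Proof.
move=> rX i; split; under eq_fun do rewrite mxE raddf_sum/=;
  apply: measurable_sum => j; have [mRe mIm] := rX j.
  under eq_fun do rewrite Re_mul.
  by apply: measurable_funB; apply: measurable_funM.
under eq_fun do rewrite Im_mul.
by apply: measurable_funD; apply: measurable_funM.
Qed.

Lemma measurable_sqr_euclidean_norm :
  random_vector X -> measurable_fun setT (fun w => euclidean_norm (X w) ^+ 2).
Proof.
move=> rX; under eq_fun do rewrite sqr_euclidean_norm.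
apply: measurable_sum => i; under eq_fun do rewrite sqr_cmod.
by apply: measurable_funD; apply: measurable_funX; [exact: (rX i).1|exact: (rX i).2].
Qed.

Lemma measurable_euclidean_norm :
  random_vector X -> measurable_fun setT (fun w => euclidean_norm (X w)).
Proof.
move=> rX.
have -> : (fun w => euclidean_norm (X w)) =
    Num.sqrt \o (fun w => euclidean_norm (X w) ^+ 2).
  by apply/funext => w /=; rewrite sqrtr_sqr ger0_norm ?euclidean_norm_ge0.
apply: measurableT_comp; last exact: measurable_sqr_euclidean_norm.
by apply: continuous_measurable_fun; exact: sqrt_continuous.
Qed.

(** |(B X)_i|^2 is a linear combination of the entries of X X^*, whose means are
those of the identity matrix. *)
Lemma has_mean_sqr_norm_mulmx (B : 'M[R[i]]_n) : isotropic P X ->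
  has_mean P (fun w => euclidean_norm (B *m X w) ^+ 2) (frobenius_norm B ^+ 2).
Proof.
move=> [intX covX].
pose Z w j k := (X w *m (X w)^t*) j k.
have mean_of f (m : R) : P.-integrable setT (EFin \o f) -> fine 'E_P[f]%E = m ->
    has_mean P f m.
  move=> fi <-; split => //; rewrite unlock fineK//.
  exact: integrable_fin_num.
have ReZ j k : has_mean P (fun w => complex.Re (Z w j k)) (j == k)%:R.
  apply: mean_of; first exact: (intX j k).1.
  have /matrixP/(_ j k) := covX; rewrite !mxE => /(congr1 (@complex.Re R)) /= ->.
  by case: eqP.
have ImZ j k : has_mean P (fun w => complex.Im (Z w j k)) 0.
  apply: mean_of; first exact: (intX j k).2.
  have /matrixP/(_ j k) := covX; rewrite !mxE => /(congr1 (@complex.Im R)) /= ->.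
  by case: eqP.
pose c i j k := B i j * (B i k)^*%R.
have -> : (fun w => euclidean_norm (B *m X w) ^+ 2) = (fun w => \sum_i \sum_j \sum_k
    (complex.Re (c i j k) * complex.Re (Z w j k) +
     - complex.Im (c i j k) * complex.Im (Z w j k))).
  apply/funext => w; rewrite sqr_euclidean_norm; apply: eq_bigr => i _.
  rewrite sqr_cmod_Re mxE rmorph_sum/= mulr_suml raddf_sum/=; apply: eq_bigr => j _.
  rewrite mulr_sumr raddf_sum/=; apply: eq_bigr => k _.
  rewrite mulNr -Re_mul /Z /c mxE big_ord1 !mxE rmorphM/=; congr complex.Re.
  ring.
have -> : frobenius_norm B ^+ 2 = \sum_i \sum_j \sum_k
    (complex.Re (c i j k) * (j == k)%:R + - complex.Im (c i j k) * 0).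
  rewrite sqr_frobenius_norm; apply: eq_bigr => i _.
  apply: eq_bigr => j _; rewrite (bigD1 j)//= eqxx mulr1 mulr0 addr0 big1 => [|k].
    by rewrite addr0 sqr_cmod_Re.
  by rewrite eq_sym => /negbTE ->; rewrite !mulr0 addr0.
do 3 apply: has_mean_sum => ?.
by apply: has_meanD; apply: has_meanZ.
Qed.

End Contraction.

Lemma one_lipschitz_norm_mulmx (R : realType) n (B : 'M[R[i]]_n) :
  (forall x, euclidean_norm (B *m x) <= euclidean_norm x) ->
  one_lipschitz (fun x => euclidean_norm (B *m x)).
Proof.
move=> contr x y; apply: le_trans (contr (x - y)); rewrite mulmxBr.
have lenB (u v : 'cV[R[i]]_n) : euclidean_norm u - euclidean_norm v <= euclidean_norm (u - v).
  by rewrite lerBlDr -[u in leLHS](subrK v) euclidean_normD.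
rewrite ler_norml lenB andbT lerNl opprB; apply: le_trans (lenB _ _) _.
by rewrite -opprB -scaleN1r euclidean_normZ /cmod normcN
  ComplexField.Normc.normc1 mul1r.
Qed.

Lemma convex_norm_mulmx (R : realType) n (B : 'M[R[i]]_n) :
  convex_on_Cn (fun x => euclidean_norm (B *m x)).
Proof.
move=> s x y /andP[s0 s1]; rewrite mulmxDr -!scalemxAr.
apply: le_trans (euclidean_normD _ _) _.
by rewrite !euclidean_normZ !cmod_real// subr_ge0.
Qed.

(** If e = |y - mu| were smaller than sqrt m / 4, then
|y^2 - mu^2| <= 2 e mu + e^2 would be less than s. *)
Lemma sqr_dist_ge (R : realType) (y mu s m : R) : 0 <= y -> 0 <= mu -> 0 < s ->
  m * mu ^+ 2 <= s ^+ 2 -> m <= s -> s <= `|y ^+ 2 - mu ^+ 2| -> m / 16 <= (y - mu) ^+ 2.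
Proof.
move=> y0 mu0 s0 mmu ms sle; rewrite leNgt; apply/negP => dlt.
set e := `|y - mu|; have e0 : 0 <= e by exact: normr_ge0.
have e2 : e ^+ 2 = (y - mu) ^+ 2 by rewrite real_normK ?num_real.
have yle : y <= mu + e by rewrite -lerBlDl ler_norm.
have se : s <= e * (2 * mu + e).
  apply: le_trans sle _; rewrite subr_sqr normrM ler_wpM2l//.
  by rewrite ger0_norm ?addr_ge0//; lra.
have emu : e * mu <= s / 4.
  rewrite -(ler_pXn2r (n := 2)) ?nnegrE ?mulr_ge0//; last by lra.
  rewrite exprMn e2; have : (y - mu) ^+ 2 * mu ^+ 2 <= m / 16 * mu ^+ 2.
    by rewrite ler_wpM2r ?sqr_ge0// ltW.
  by move=> h; rewrite expr_div_n; lra.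
by lra.
Qed.

(** By [sqr_dist_ge] the event forces ||B X|| to be at distance at least
sqrt m / 4 from ||B||_F, while ||B||_F is within sqrt v of the median M, where
v = C0 K^2 / C0'.  If sqrt v <= sqrt m / 8 half of the distance to M remains and
the concentration hypothesis applies.  Otherwise C0' K^-2 m / 64 < C0, and
the factor exp(1 + C0) makes the bound larger than 1. *)
Lemma contraction_concentration (R : realType) (C0 C0' : R) n (d : measure_display)
    (T : measurableType d) (P : probability T R) (K : R) (X : T -> 'cV[R[i]]_n) :
  0 < C0 -> 0 < C0' -> 0 < K ->
  random_vector X -> isotropic P X -> concentrated P C0 C0' K X ->
  forall (B : 'M[R[i]]_n) (s m : R),
  (forall x, euclidean_norm (B *m x) <= euclidean_norm x) ->
  0 < s -> 0 <= m -> m * frobenius_norm B ^+ 2 <= s ^+ 2 -> m <= s ->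
  (P [set w | (s <= `|euclidean_norm (B *m X w) ^+ 2 - frobenius_norm B ^+ 2|)%R]
    <= (expR (1 + C0) * expR (- (C0' / 64 * K ^- 2 * m)))%:E)%E.
Proof.
move=> hC0 hC0' K0 rX isoX concX B s m contr s0 m0 mF ms.
have [M [[Mle _] tail]] := concX _ (convex_norm_mulmx B) (one_lipschitz_norm_mulmx contr).
pose Y w := euclidean_norm (B *m X w); pose mu := frobenius_norm B.
have Y0 w : 0 <= Y w := euclidean_norm_ge0 _.
have mu0 : 0 <= mu := frobenius_norm_ge0 _.
have mY : measurable_fun setT Y.
  exact: measurable_euclidean_norm (random_vector_mulmx B rX).
(* If M < 0, the event Y <= M is empty and cannot have probability 1/2. *)
have M0 : 0 <= M.
  rewrite leNgt; apply/negP => M_lt0; move: Mle.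
  rewrite (_ : [set w | _] = set0) ?measure0 ?lee_fin; first by lra.
  apply/seteqP; split=> w //=; rewrite leNgt => /negP; apply.
  exact: lt_le_trans (Y0 w).
pose v := C0 / (C0' / K ^+ 2).
have K2 : 0 < K ^+ 2 by rewrite exprn_gt0.
have v0 : 0 < v by rewrite !divr_gt0.
have near : (mu - M) ^+ 2 <= v.
  apply: (rms_near_center mY mu0 M0 (has_mean_sqr_norm_mulmx B isoX)).
  apply: integral_sqr_le_of_tail; [exact: measurable_funB|exact: ltW|exact: divr_gt0|].
  by move=> t t0; rewrite mulrAC -mulrA; exact: tail.
have mdev c g : measurable_fun setT (g : T -> R) -> measurable [set w | (c <= `|g w|)%R].
  move=> mg; rewrite -[X in measurable X]setTI; apply: measurable_fun_le => //.
  exact: measurableT_comp.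
have mE : measurable [set w | (s <= `|Y w ^+ 2 - mu ^+ 2|)%R].
  by apply: mdev; apply: measurable_funB => //; exact: measurable_funX.
have [mbig|msmall] := leP v (m / 64); last first.
  apply: le_trans (probability_le1 P mE) _.
  rewrite -expRD lee_fin -[leLHS]expR0 ler_expR.
  move: msmall; rewrite ltr_pdivlMr ?divr_gt0// => msmall.
  have -> : C0' / 64 * K ^- 2 * m = m / 64 * (C0' / K ^+ 2) by ring.
  by lra.
pose r := Num.sqrt (m / 64).
have r2 : r ^+ 2 = m / 64 by rewrite sqr_sqrtr// divr_ge0.
have r0 : 0 < r by rewrite sqrtr_gt0; exact: lt_le_trans mbig.
have -> : expR (- (C0' / 64 * K ^- 2 * m)) = expR (- (C0' * (r ^+ 2 / K ^+ 2))).
  by congr (expR (- _)); rewrite r2; field; lra.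
apply: (@le_trans _ _ (P [set w | (r <= `|Y w - M|)%R])).
  apply: le_measure; rewrite ?inE//; first by apply: mdev; exact: measurable_funB.
  move=> w /= /(sqr_dist_ge (Y0 w) mu0 s0 mF ms) far.
  have far' : 2 * r <= `|Y w - mu|.
    rewrite -(ler_pXn2r (n := 2)) ?nnegrE ?mulr_ge0 ?(ltW r0)//.
    by rewrite exprMn r2 real_normK ?num_real//; lra.
  have near' : `|mu - M| <= r.
    rewrite -(ler_pXn2r (n := 2)) ?nnegrE ?(ltW r0)// real_normK ?num_real//.
    by rewrite r2; lra.
  have := ler_distD M (Y w) mu; rewrite (distrC M); lra.
apply: le_trans (tail _ r0) _; rewrite lee_fin ler_wpM2r ?expR_ge0//.
by have := expR_ge1Dx (1 + C0); lra.
Qed.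

(** * Union bounds *)

Section UnionBound.
Context (d : measure_display) (T : measurableType d) (R : realType).
Variable P : probability T R.

Lemma measure_bigsetU_le_card (I : finType) (A : I -> set T) (b : R) :
  (forall i, measurable (A i)) -> (forall i, (P (A i) <= b%:E)%E) ->
  (P (\big[setU/set0]_i A i) <= (#|I|%:R * b)%:E)%E.
Proof.
move=> mA Ab; have -> : #|I| = size (index_enum I) by rewrite cardT enumT [index_enum _]unlock.
elim: (index_enum I) => [|i s IHs].
  by rewrite big_nil measure0 /= mul0r.
rewrite big_cons; apply: le_trans (measureU2 _ _ _) _ => //.
  by apply: bigsetU_measurable.
have -> : (size (i :: s))%:R * b = b + (size s)%:R * b.
  by rewrite /= -natr1 mulrDl mul1r addrC.
by rewrite EFinD; exact: leeD (Ab i) IHs.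
Qed.

(** If every |g i| were below t i then |sum g| < sum t <= tot; the inequality is
strict because the index type is inhabited by i0. *)
Lemma union_bound_sum (I : finType) (i0 : I) (g : I -> T -> R) (t : I -> R) (tot b : R) :
  (forall i, measurable_fun setT (g i)) -> \sum_i t i <= tot ->
  (forall i, (P [set w | (t i <= `|g i w|)%R] <= b%:E)%E) ->
  (P [set w | (tot <= `|\sum_i g i w|)%R] <= (#|I|%:R * b)%:E)%E.
Proof.
move=> mg tle gb.
have mS (c : R) f : measurable_fun setT (f : T -> R) -> measurable [set w | (c <= `|f w|)%R].
  move=> mf; rewrite -[X in measurable X]setTI; apply: measurable_fun_le => //.
  exact: measurableT_comp.
apply: le_trans (measure_bigsetU_le_card _ gb); last by move=> i; exact: mS.
apply: le_measure; rewrite ?inE.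
- by apply: mS; exact: measurable_sum.
- by apply: bigsetU_measurable => i _; exact: mS.
move=> w /= totle; have [i ti] : exists i, t i <= `|g i w|.
  apply: contrapT => /forallNP h; have : tot < tot; last by rewrite ltxx.
  apply: le_lt_trans totle _; apply: le_lt_trans (ler_norm_sum _ _ _) _.
  apply: lt_le_trans tle; apply: ltr_sum => [|i _].
    by apply/hasP; exists i0; rewrite ?mem_index_enum.
  by rewrite ltNge; apply/negP/h.
by rewrite (bigD1 i)//=; left.
Qed.

End UnionBound.

(** * Diagonal forms with eigenvalues in the unit interval *)

(** Levels stop at N: level N collects everything below 2^-N, where x need not
be comparable to the level. *)
Lemma dyadic_level (R : realType) (N : nat) (x : R) : x <= 1 ->
  exists k : 'I_N.+1, x <= 2^-1 ^+ k /\ ((k : nat) = N \/ 2^-1 ^+ k <= 2 * x).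
Proof.
move=> x1; elim: N => [|N [k [xk kN]]].
  by exists ord0; rewrite expr0; split => //; left.
have [xN|Nx] := leP x (2^-1 ^+ N.+1).
  by exists ord_max; split => //; left.
exists (widen_ord (leqnSn _) k); split => //=; right.
case: kN => // kN; rewrite kN; move: Nx; rewrite exprS; lra.
Qed.

Lemma sum_half_powers (R : realType) (L : nat) : \sum_(k < L) 2^-1 ^+ k <= 2 :> R.
Proof.
suff -> : \sum_(k < L) 2^-1 ^+ k = 2 - 2 * 2^-1 ^+ L :> R.
  by rewrite gerBl mulr_ge0 ?exprn_ge0.
elim: L => [|L IH]; first by rewrite big_ord0 expr0 mulr1 subrr.
by rewrite big_ord_recr /= IH exprS; lra.
Qed.

Section WeightedForm.
Context (R : realType) (C0 C0' : R) (n : nat) (d : measure_display)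
  (T : measurableType d) (P : probability T R) (K : R) (X : T -> 'cV[R[i]]_n).
Hypotheses (hC0 : 0 < C0) (hC0' : 0 < C0') (K0 : 0 < K).
Hypotheses (rX : random_vector X) (isoX : isotropic P X).
Hypothesis concX : concentrated P C0 C0' K X.
Variable U : 'M[R[i]]_n.
Hypothesis uU : U \is unitarymx.

Definition centered_form (a : 'I_n -> R) (w : T) : R :=
  \sum_i a i * cmod ((U *m X w) i 0) ^+ 2 - \sum_i a i.

Lemma centered_formE a w :
  centered_form a w = \sum_i a i * (cmod ((U *m X w) i 0) ^+ 2 - 1).
Proof. by rewrite /centered_form -sumrB; apply: eq_bigr => i _; ring. Qed.

Let bound (m : R) : R := expR (1 + C0) * expR (- (C0' / 64 * K ^- 2 * m)).

Lemma measurable_centered_form a : measurable_fun setT (centered_form a).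
Proof.
apply: measurable_funB => //; apply: measurable_sum => i.
apply: measurable_funM => //; under eq_fun do rewrite sqr_cmod.
have [mRe mIm] := random_vector_mulmx U rX i.
by apply: measurable_funD; apply: measurable_funX.
Qed.

(** The quality of this bound is governed by sum_i a_i, not by sum_i a_i^2, so it
is sharp only for weights that are all 0 or comparable to 1. *)
Lemma flat_form_concentration (a : 'I_n -> R) (s m : R) :
  (forall i, 0 <= a i <= 1) -> 0 < s -> 0 <= m ->
  m * \sum_i a i <= s ^+ 2 -> m <= s ->
  (P [set w | (s <= `|centered_form a w|)%R] <= (bound m)%:E)%E.
Proof.
move=> a01 s0 m0 ma ms.
pose B : 'M[R[i]]_n := diag_mx (\row_i (Num.sqrt (a i))%:C) *m U.
have sqrBE (x : 'cV_n) : euclidean_norm (B *m x) ^+ 2 =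
    \sum_i a i * cmod ((U *m x) i 0) ^+ 2.
  rewrite sqr_euclidean_norm; apply: eq_bigr => i _.
  rewrite -mulmxA mul_diag_mx mxE [X in X * _]mxE cmodM exprMn cmod_real ?sqrtr_ge0//.
  by rewrite sqr_sqrtr//; have /andP[] := a01 i.
have frobB : frobenius_norm B ^+ 2 = \sum_i a i.
  rewrite frobenius_norm_unitaryr// sqr_frobenius_norm; apply: eq_bigr => i _.
  rewrite (bigD1 i)//= big1 => [|j /negbTE ji].
    rewrite !mxE eqxx mulr1n cmod_real ?sqrtr_ge0// sqr_sqrtr ?addr0//.
    by have /andP[] := a01 i.
  by rewrite !mxE eq_sym ji mulr0n cmod_real// expr0n.
have contr (x : 'cV_n) : euclidean_norm (B *m x) <= euclidean_norm x.
  rewrite -(ler_pXn2r (n := 2)) ?nnegrE ?euclidean_norm_ge0//.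
  rewrite -(euclidean_norm_unitary x uU) sqrBE sqr_euclidean_norm.
  by apply: ler_sum => i _; rewrite ler_piMl ?sqr_ge0//; have /andP[] := a01 i.
have := contraction_concentration hC0 hC0' K0 rX isoX concX contr s0 m0.
rewrite frobB => /(_ ma ms).
by under eq_set do rewrite sqrBE.
Qed.

(** Divided by W k = 2^-k, the eigenvalues of level k become weights a k in the
unit interval, and f k = (W k)^2 sum_i a k i is the contribution of that level
to the variance.  These contributions add up to at most 3 G: at a level k < N
one has W k <= 2 lam_i, and the last level contributes at most
n 2^-2N <= 1 <= G.  The share t k of t satisfies t k >= m W k / 4 thanks to its
last term, and (t k)^2 >= m f k / 12 by the inequality of arithmetic and
geometric means applied to its first two terms, f k / (12 G) and 1 / (4 L); the
shares sum to at most t (1/4 + 1/4 + 1/2). *)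
Lemma nonneg_form_concentration (N : nat) (lam : 'I_n -> R) (G t m : R) :
  (n <= 2 ^ N)%N -> (forall i, 0 <= lam i <= 1) ->
  \sum_i lam i ^+ 2 <= G -> 1 <= G -> 0 < t -> 0 <= m ->
  m * N.+1%:R * G <= t ^+ 2 -> m <= t ->
  (P [set w | (t <= `|centered_form lam w|)%R] <= (N.+1%:R * bound (m / 12))%:E)%E.
Proof.
move=> nN lam01 lamG G1 t0 m0 mG mt.
have [kap kapP] : exists kap : 'I_n -> 'I_N.+1, forall i, lam i <= 2^-1 ^+ kap i /\
    ((kap i : nat) = N \/ 2^-1 ^+ kap i <= 2 * lam i).
  have : forall i, exists k : 'I_N.+1, lam i <= 2^-1 ^+ k /\
    ((k : nat) = N \/ 2^-1 ^+ k <= 2 * lam i).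
    by move=> i; apply: dyadic_level; have /andP[] := lam01 i.
  by move/fin_all_exists.
pose W (k : 'I_N.+1) : R := 2^-1 ^+ k.
have W0 k : 0 < W k by rewrite exprn_gt0.
pose a k i := if kap i == k then lam i / W k else 0.
pose f k := W k * (W k * \sum_i a k i).
pose L : R := N.+1%:R; have L0 : 0 < L by rewrite ltr0n.
pose tk k := t * (f k / (12 * G) + 1 / (4 * L) + W k / 4).
have a01 k i : 0 <= a k i <= 1.
  rewrite /a; case: eqP => [kk|_]; last by rewrite lexx ler01.
  have /andP[lam0 _] := lam01 i; have [lamW _] := kapP i.
  by rewrite divr_ge0 ?(ltW (W0 _))//= ler_pdivrMr// mul1r -kk.
have f0 k : 0 <= f k.
  rewrite !mulr_ge0 ?(ltW (W0 _))//; apply: sumr_ge0 => i _.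
  by have /andP[] := a01 k i.
have WaE i (F : 'I_N.+1 -> R) : \sum_k F k * (W k * a k i) = F (kap i) * lam i.
  rewrite (bigD1 (kap i))//= big1 => [|k /negbTE kk].
    by rewrite /a eqxx addr0; congr (_ * _); rewrite mulrC divfK ?gt_eqF.
  by rewrite /a eq_sym kk !mulr0.
have sum_f : \sum_k f k <= 3 * G.
  have -> : \sum_k f k = \sum_i W (kap i) * lam i.
    under eq_bigr => k _ do rewrite /f !mulr_sumr.
    by rewrite exchange_big/=; apply: eq_bigr => i _; exact: WaE.
  pose q : R := 2^-1 ^+ N; have q0 : 0 <= q by rewrite exprn_ge0.
  have q1 : q <= 1 by rewrite exprn_ile1//; lra.
  have nq : n%:R * q <= 1.
    rewrite [leRHS](_ : _ = (2 ^ N)%:R * q); last first.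
      by rewrite natrX -exprMn divff// expr1n.
    by rewrite ler_wpM2r// ler_nat.
  apply: (@le_trans _ _ (\sum_(i < n) (2 * lam i ^+ 2 + q * q))).
    apply: ler_sum => i _; have /andP[lam0 _] := lam01 i; have [] := kapP i.
    rewrite -/(W (kap i)) => lamW; have := W0 (kap i) => Wk0.
    case=> [kN|Wlam].
      have Wq : W (kap i) = q by rewrite /W kN.
      by rewrite Wq in lamW; rewrite Wq -[leLHS]add0r lerD ?mulr_ge0 ?sqr_ge0// ler_wpM2l.
    rewrite -[leLHS]addr0 lerD ?mulr_ge0// expr2 mulrA.
    by rewrite ler_wpM2r.
  rewrite big_split/= -mulr_sumr sumr_const card_ord -[_ *+ n]mulr_natl mulrA.
  have : n%:R * q * q <= 1 by rewrite mulr_ile1 ?mulr_ge0.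
  by lra.
have sum_tk : \sum_k tk k <= t.
  rewrite -mulr_sumr ler_piMr ?(ltW t0)// !big_split/= -!mulr_suml.
  rewrite sumr_const card_ord -[_ *+ N.+1]mulr_natl -/L.
  have -> : L * 1 / (4 * L) = 1 / 4 by field; lra.
  have h1 : (\sum_k f k) / (12 * G) <= 1 / 4 by rewrite ler_pdivrMr; lra.
  have h2 : \sum_k W k <= 2 by exact: sum_half_powers.
  by lra.
have splitE w : centered_form lam w = \sum_k W k * centered_form (a k) w.
  under eq_bigr => k _ do rewrite centered_formE mulr_sumr.
  rewrite exchange_big centered_formE/=; apply: eq_bigr => i _.
  rewrite mulrC -(WaE i (fun=> cmod ((U *m X w) i 0) ^+ 2 - 1)).
  by apply: eq_bigr => k _; ring.
rewrite (_ : [set w | _] = [set w | t <= `|\sum_k W k * centered_form (a k) w|]); last first.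
  by apply: eq_set => w; rewrite splitE.
rewrite -[X in X%:R * _](card_ord N.+1).
apply: (union_bound_sum ord0 _ sum_tk) => k.
  by apply: measurable_funM => //; exact: measurable_centered_form.
have tkf : tk k ^+ 2 >= m / 12 * f k.
  have G0 : 0 < G by lra.
  have fk := f0 k; have Wk := W0 k.
  pose u := f k / (12 * G); pose v := 1 / (4 * L).
  have u0 : 0 <= u by rewrite divr_ge0// mulr_ge0// ltW.
  have v0 : 0 <= v by rewrite divr_ge0// mulr_ge0// ltW.
  apply: (@le_trans _ _ (t ^+ 2 * (4 * u * v))).
    have -> : m / 12 * f k = (m * L * G) * (4 * u * v) by rewrite /u /v; field; lra.
    by apply: ler_wpM2r mG; apply: mulr_ge0 => //; apply: mulr_ge0.
  rewrite exprMn ler_wpM2l ?sqr_ge0// -/u -/v.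
  rewrite -subr_ge0; have -> : (u + v + W k / 4) ^+ 2 - 4 * u * v =
      (u - v) ^+ 2 + (u + v) * W k / 2 + (W k / 4) ^+ 2 by field.
  by rewrite !addr_ge0 ?sqr_ge0// divr_ge0// mulr_ge0 ?addr_ge0// ltW.
have tkW : m / 12 * W k <= tk k.
  have fk := f0 k; have Wk := W0 k.
  have : m * W k <= t * W k by rewrite ler_wpM2r// ltW.
  have : 0 <= t * (f k / (12 * G) + 1 / (4 * L)).
    apply: mulr_ge0; first exact: ltW.
    by apply: addr_ge0; apply: divr_ge0 => //; apply: mulr_ge0 => //; lra.
  have : 0 <= m * W k by rewrite mulr_ge0// ltW.
  rewrite /tk [t * (_ + W k / 4)]mulrDr; move: (t * (_ + _)) => y.
  by lra.
have tk0 : 0 < tk k.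
  rewrite mulr_gt0// ltr_wpDl ?divr_gt0//.
  by rewrite addr_ge0// divr_ge0// mulr_ge0// ?(ltW L0)// ?(le_trans ler01).
rewrite (_ : [set w | _] = [set w | tk k / W k <= `|centered_form (a k) w|]); last first.
  apply: eq_set => w; rewrite normrM (gtr0_norm (W0 k)).
  by rewrite ler_pdivrMr// mulrC.
apply: flat_form_concentration => //.
- exact: divr_gt0.
- by rewrite divr_ge0.
- by rewrite expr_div_n ler_pdivlMr ?exprn_gt0//; apply: le_trans tkf; rewrite /f; lra.
- by rewrite ler_pdivlMr.
Qed.

(** Positive and negative parts of lam are nonnegative weights whose squares are
bounded by those of lam. *)
Lemma signed_form_concentration (N : nat) (lam : 'I_n -> R) (G t m : R) :
  (n <= 2 ^ N)%N -> (forall i, `|lam i| <= 1) ->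
  \sum_i lam i ^+ 2 <= G -> 1 <= G -> 0 < t -> 0 <= m ->
  m * N.+1%:R * G <= t ^+ 2 -> m <= t ->
  (P [set w | (2 * t <= `|centered_form lam w|)%R] <=
    (2 * (N.+1%:R * bound (m / 12)))%:E)%E.
Proof.
move=> nN lam1 lamG G1 t0 m0 mG mt.
pose sgn (b : bool) : R := if b then 1 else -1.
pose part (b : bool) i := Num.max (sgn b * lam i) 0.
have part_concentration b :
    (P [set w | (t <= `|sgn b * centered_form (part b) w|)%R] <=
      (N.+1%:R * bound (m / 12))%:E)%E.
  rewrite (_ : [set w | _] = [set w | (t <= `|centered_form (part b) w|)%R]).
    apply: (nonneg_form_concentration (G := G)) => // [i|].
      rewrite /part le_max lexx orbT/= ge_max ler01 andbT.
      by have := lam1 i; rewrite ler_norml /sgn; case: b; lra.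
    apply: le_trans lamG; apply: ler_sum => i _; rewrite /part maxEle.
    by case: ifP => _; rewrite ?expr0n ?sqr_ge0// /sgn; case: b;
      rewrite exprMn ?sqrrN expr1n mul1r.
  by apply: eq_set => w; rewrite normrM /sgn; case: b; rewrite ?normrN normr1 mul1r.
rewrite (_ : [set w | _] =
    [set w | (2 * t <= `|\sum_b sgn b * centered_form (part b) w|)%R]); last first.
  apply: eq_set => w; congr (_ <= `|_|); rewrite big_bool /= mul1r mulN1r.
  rewrite !centered_formE -sumrB; apply: eq_bigr => i _.
  rewrite -mulrBl; congr (_ * _); rewrite /part /sgn mul1r mulN1r.
  by rewrite /Num.max; case: ifP; case: ifP; lra.
suff : (P [set w | (2 * t <= `|\sum_b sgn b * centered_form (part b) w|)%R] <=
    (#|{: bool}|%:R * (N.+1%:R * bound (m / 12)))%:E)%E by rewrite card_bool.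
apply: (union_bound_sum true (t := fun=> t)) => //.
  by move=> b; apply: measurable_funM => //; exact: measurable_centered_form.
by rewrite sumr_const card_bool mulr_natl.
Qed.

End WeightedForm.

(** * Quadratic forms *)

(** The eigenvalues divided by ||A|| lie in [-1, 1]; the parameter
G = (||A||_F / ||A||)^2 is at least 1 because ||A|| <= ||A||_F. *)
Lemma re_quadratic_form_concentration (R : realType) (C0 C0' : R) n (d : measure_display)
    (T : measurableType d) (P : probability T R) (K : R) (X : T -> 'cV[R[i]]_n) :
  0 < C0 -> 0 < C0' -> 0 < K ->
  random_vector X -> isotropic P X -> concentrated P C0 C0' K X ->
  forall (N : nat) (A : 'M[R[i]]_n) (t m : R),
  (n <= 2 ^ N)%N -> 0 < operator_norm A -> 0 < t -> 0 <= m ->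
  m * N.+1%:R * frobenius_norm A ^+ 2 <= t ^+ 2 -> m * operator_norm A <= t ->
  (P [set w | (2 * t <= `|complex.Re (((X w)^t* *m A *m X w) 0 0 - \tr A)|)%R] <=
    (2 * (N.+1%:R * (expR (1 + C0) * expR (- (C0' / 64 * K ^- 2 * (m / 12))))))%:E)%E.
Proof.
move=> hC0 hC0' K0 rX isoX concX N A t m nN op0 t0 m0 mF mop.
have [U [lam [uU quadE trE lam_op lam_F]]] := re_quadratic_form_diagonal A.
set op := operator_norm A in op0 mop lam_op *.
pose lam' i := lam i / op.
rewrite (_ : [set w | _] =
    [set w | (2 * (t / op) <= `|centered_form X U lam' w|)%R]); last first.
  apply: eq_set => w; rewrite raddfB/= quadE trE.
  have -> : centered_form X U lam' w =
      (\sum_i lam i * cmod ((U *m X w) i 0) ^+ 2 - \sum_i lam i) / op.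
    rewrite mulrBl !mulr_suml; congr (_ - _); apply: eq_bigr => i _.
    by rewrite /lam' mulrAC.
  by rewrite normrM (gtr0_norm (x := op^-1)) ?invr_gt0// mulrA ler_pM2r// invr_gt0.
have op2 : 0 < op ^+ 2 by rewrite exprn_gt0.
apply: (signed_form_concentration hC0 hC0' K0 rX isoX concX uU
  (G := frobenius_norm A ^+ 2 / op ^+ 2)) => //.
- by move=> i; rewrite /lam' normrM (gtr0_norm (x := op^-1)) ?invr_gt0// ler_pdivrMr// mul1r.
- rewrite ler_pdivlMr// mulr_suml; apply: le_trans lam_F; apply: ler_sum => i _.
  by rewrite /lam' expr_div_n divfK// gt_eqF.
- rewrite ler_pdivlMr// mul1r ler_pXn2r ?nnegrE ?(ltW op0) ?frobenius_norm_ge0//.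
  exact: operator_norm_le_frobenius_norm.
- exact: divr_gt0.
- by rewrite mulrA expr_div_n ler_pM2r// invr_gt0.
- by rewrite ler_pdivlMr.
Qed.

Section UnimodularScaling.
Variables (R : realType) (m n : nat) (z : R[i]).
Hypothesis z1 : cmod z = 1.

Lemma frobenius_norm_unimodularZ (A : 'M[R[i]]_(m, n)) :
  frobenius_norm (z *: A) = frobenius_norm A.
Proof.
congr (Num.sqrt _); do 2 apply: eq_bigr => ? _.
by rewrite mxE cmodM z1 mul1r.
Qed.

Lemma operator_norm_unimodularZ (A : 'M[R[i]]_(m, n)) :
  operator_norm (z *: A) = operator_norm A.
Proof.
congr sup; apply: eq_imagel => x _.
by rewrite -scalemxAl euclidean_normZ z1 mul1r.
Qed.

End UnimodularScaling.

Lemma cmod_le_Re_Im (R : realType) (z : R[i]) :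
  cmod z <= `|complex.Re z| + `|complex.Im z|.
Proof.
rewrite -(ler_pXn2r (n := 2)) ?nnegrE ?cmod_ge0 ?addr_ge0//.
rewrite sqr_cmod sqrrD !real_normK ?num_real//.
by rewrite -addrA lerD2l lerDr mulrn_wge0// mulr_ge0.
Qed.

Lemma ln_nat_ge_half (R : realType) (n : nat) : (2 <= n)%N -> 2^-1 <= ln (n%:R : R).
Proof.
move=> n2; have ln2 : 2^-1 <= ln (2 : R).
  have /le_ln1Dx : -1 < - 2^-1 :> R by lra.
  rewrite (_ : 1 - 2^-1 = 2^-1 :> R); last by field.
  by rewrite lnV ?posrE// lerN2.
by apply: le_trans ln2 _; rewrite ler_ln ?posrE ?ler_nat// ltr0n (leq_trans _ n2).
Qed.

(** The left-hand side is the number of dyadic levels 0, ..., N for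
N = 1 + floor (log_2 n), for which 2^N > n. *)
Lemma trunc_log_le_ln (R : realType) (n : nat) : (2 <= n)%N ->
  (trunc_log 2 n).+2%:R <= 6 * ln (n%:R : R).
Proof.
move=> n2; have ln_n := ln_nat_ge_half R n2.
have ln2 := ln_nat_ge_half R (leqnn 2).
have n0 : (0 < n)%N by rewrite (leq_trans _ n2).
have : (trunc_log 2 n)%:R * ln 2 <= ln (n%:R : R).
  rewrite mulr_natl -lnXn// ler_ln ?posrE ?exprn_gt0 ?ltr0n//.
  by rewrite -natrX ler_nat trunc_logP.
have : (trunc_log 2 n)%:R * 2^-1 <= (trunc_log 2 n)%:R * ln (2 : R).
  by rewrite ler_wpM2l.
have -> : (trunc_log 2 n).+2%:R = (trunc_log 2 n)%:R + 2 :> R.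
  by rewrite -(natrD _ _ 2) addn2.
move: (trunc_log 2 n)%:R => a; lra.
Qed.

Section MeasurableQuadraticForm.
Context (R : realType) (d : measure_display) (T : measurableType d) (n : nat).

Lemma measurable_quadratic_form (X : T -> 'cV[R[i]]_n) (A : 'M[R[i]]_n) (c : R[i]) :
  random_vector X ->
  let q w := ((X w)^t* *m A *m X w) 0 0 - c in
  measurable_fun setT (fun w => complex.Re (q w)) /\
  measurable_fun setT (fun w => complex.Im (q w)).
Proof.
move=> rX q.
have qE w : q w = (\sum_i (X w i 0)^*%R * (A *m X w) i 0) - c.
  by rewrite /q -mulmxA mxE; congr (_ - _); apply: eq_bigr => i _; rewrite !mxE.
have ReJ (z : R[i]) : complex.Re (z^*)%R = complex.Re z by case: z.
have ImJ (z : R[i]) : complex.Im (z^*)%R = - complex.Im z by case: z.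
split; under eq_fun do rewrite qE raddfB raddf_sum/=; apply: measurable_funB => //;
  apply: measurable_sum => i; have [mRe mIm] := rX i;
  have [mReA mImA] := random_vector_mulmx A rX i.
  under eq_fun do rewrite Re_mul ReJ ImJ.
  by apply: measurable_funB; apply: measurable_funM => //; exact: measurable_funN.
under eq_fun do rewrite Im_mul ReJ ImJ.
by apply: measurable_funD; apply: measurable_funM => //; exact: measurable_funN.
Qed.

Lemma measurable_cmod (f : T -> R[i]) :
  measurable_fun setT (fun w => complex.Re (f w)) ->
  measurable_fun setT (fun w => complex.Im (f w)) ->
  measurable_fun setT (fun w => cmod (f w)).
Proof.
move=> mRe mIm.
have -> : (fun w => cmod (f w)) =
    Num.sqrt \o (fun w => complex.Re (f w) ^+ 2 + complex.Im (f w) ^+ 2).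
  by apply/funext => w /=; rewrite -sqr_cmod sqrtr_sqr ger0_norm ?cmod_ge0.
apply: measurableT_comp; last by apply: measurable_funD; exact: measurable_funX.
by apply: continuous_measurable_fun; exact: sqrt_continuous.
Qed.

End MeasurableQuadraticForm.

Theorem theorem1p4 (R : realType) (C0 C0' : R) (hC0 : 0 < C0) (hC0' : 0 < C0') :
  exists C C' : R, 0 < C /\ 0 < C' /\
  forall (n : nat) (d : measure_display) (T : measurableType d)
    (P : probability T R) (K : R) (X : T -> 'cV[R[i]]_n),
  (2 <= n)%N -> 0 < K ->
  random_vector X -> isotropic P X -> concentrated P C0 C0' K X ->
  forall (A : 'M[R[i]]_n) (t : R), A != 0 -> 0 < t ->
    (P [set w | (t <= cmod (((X w)^t* *m A *m X w) 0 0 - \tr A))%R]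
       <= (C * ln n%:R *
           expR (- (C' * K ^- 2 *
              Num.min (t ^+ 2 / (frobenius_norm A ^+ 2 * ln n%:R))
                      (t / operator_norm A))))%:E)%E.
Proof.
(* 24 = 2 * 2 * 6: real and imaginary parts, two signs, at most 6 ln n levels.
   The rate C0' / 64 of a single level is divided by 12 for the sharing of t, and
   by 96 = 6 * 4^2 for the number of levels and for the quarter t / 4 that is
   left to each sign of each part. *)
exists (24 * expR (1 + C0)), (C0' / 64 / 12 / 96).
split; first by rewrite mulr_gt0 ?expR_gt0.
split; first by rewrite !divr_gt0.
move=> n d T P K X n2 K0 rX isoX concX A t _ t0.
set q := fun w => ((X w)^t* *m A *m X w) 0 0 - \tr A.
set op := operator_norm A; set F := frobenius_norm A.
set mn := Num.min _ _.
have ln_n : 2^-1 <= ln n%:R :> R := ln_nat_ge_half R n2.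
have op_ge0 : 0 <= op := operator_norm_ge0 A.
have opF : op <= F := operator_norm_le_frobenius_norm A.
have [mRe mIm] := measurable_quadratic_form A (\tr A) rX.
have mcmod : measurable_fun setT (fun w => cmod (q w)) by exact: measurable_cmod.
have mE (f : T -> R) c : measurable_fun setT f -> measurable [set w | (c <= f w)%R].
  by move=> mf; rewrite -[X in measurable X]setTI; apply: measurable_fun_le.
(* If the operator norm vanishes the exponent is 0, and C ln n >= 1. *)
have [op_gt0|op_le0] := ltP 0 op; last first.
  have op_eq0 : op = 0 by lra.
  apply: le_trans (probability_le1 P (mE _ _ mcmod)) _; rewrite lee_fin.
  have mn0 : mn <= 0 by rewrite /mn op_eq0 invr0 mulr0 ge_min lexx orbT.
  have : 1 <= expR (- (C0' / 64 / 12 / 96 * K ^- 2 * mn)).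
    rewrite -[leLHS]expR0 ler_expR oppr_ge0 mulr_ge0_le0// mulr_ge0//.
      by rewrite !divr_ge0// ltW.
    by rewrite invr_ge0 exprn_ge0// ltW.
  have : 1 <= expR (1 + C0) by rewrite -[leLHS]expR0 ler_expR; lra.
  move=> e1 e2; rewrite -[leLHS]mulr1 ler_pM//.
  have : 2^-1 <= expR (1 + C0) * ln n%:R.
    by rewrite -[leLHS]mul1r ler_pM.
  by lra.
have F_gt0 : 0 < F by exact: lt_le_trans opF.
pose N := (trunc_log 2 n).+1.
have nN : (n <= 2 ^ N)%N by rewrite ltnW// trunc_log_ltn.
have Nln : N.+1%:R <= 6 * ln n%:R :> R := trunc_log_le_ln R n2.
have ln_gt0 : 0 < ln n%:R :> R by lra.
have mn0 : 0 <= mn.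
  by rewrite le_min !divr_ge0 ?sqr_ge0// ?(ltW t0)// mulr_ge0 ?sqr_ge0// ltW.
have mn_F : mn * (F ^+ 2 * ln n%:R) <= t ^+ 2.
  by rewrite -ler_pdivlMr ?mulr_gt0 ?exprn_gt0// ge_min lexx.
have mn_op : mn * op <= t by rewrite -ler_pdivlMr// ge_min lexx orbT.
have tail (z : R[i]) : cmod z = 1 ->
    (P [set w | (t / 2 <= `|complex.Re (z * q w)|)%R] <=
     (2 * (N.+1%:R * (expR (1 + C0) *
        expR (- (C0' / 64 * K ^- 2 * (mn / 96 / 12))))))%:E)%E.
  move=> z1.
  have -> : [set w | (t / 2 <= `|complex.Re (z * q w)|)%R] = [set w | (2 * (t / 4) <=
      `|complex.Re (((X w)^t* *m (z *: A) *m X w) 0 0 - \tr (z *: A))|)%R].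
    apply: eq_set => w; rewrite -scalemxAr -scalemxAl mxE mxtraceZ -mulrBr.
    by congr (_ <= _); field.
  apply: re_quadratic_form_concentration hC0 hC0' K0 rX isoX concX _ _ _ _ nN _ _ _ _ _.
  - by rewrite operator_norm_unimodularZ.
  - exact: divr_gt0.
  - by rewrite divr_ge0.
  - rewrite frobenius_norm_unimodularZ// -/F.
    apply: (@le_trans _ _ (mn / 96 * (6 * ln n%:R) * F ^+ 2)).
      by rewrite ler_wpM2r ?sqr_ge0// ler_wpM2l// divr_ge0.
    by rewrite expr_div_n; lra.
  - by rewrite operator_norm_unimodularZ// -/op; lra.
pose ev (b : bool) := [set w | (t / 2 <= `|complex.Re ((if b then 1 else 'i) * q w)|)%R].
have Re_i w : complex.Re ('i * q w) = - complex.Im (q w).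
  by rewrite Re_mul /= mul0r mul1r sub0r.
have mev b : measurable (ev b).
  apply: mE; apply: measurableT_comp => //; case: b.
    by under eq_fun do rewrite mul1r.
  by under eq_fun do rewrite Re_i; exact: measurable_funN.
have cover : [set w | (t <= cmod (q w))%R] `<=` \big[setU/set0]_b ev b.
  move=> w /= tq; rewrite big_bool /ev /= mul1r Re_i normrN.
  have [tRe|Ret] := leP (t / 2) `|complex.Re (q w)|; first by left.
  by right => /=; have := cmod_le_Re_Im (q w); lra.
have ev_le b : (P (ev b) <= (12 * ln n%:R * expR (1 + C0) *
    expR (- (C0' / 64 / 12 / 96 * K ^- 2 * mn)))%:E)%E.
  apply: le_trans (tail _ _) _.
    by case: b; rewrite /cmod /= ?expr1n ?expr0n /= ?addr0 ?add0r sqrtr1.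
  have -> : C0' / 64 / 12 / 96 * K ^- 2 * mn = C0' / 64 * K ^- 2 * (mn / 96 / 12).
    by ring.
  by rewrite lee_fin !mulrA ler_wpM2r ?expR_ge0// ler_wpM2r ?expR_ge0//; lra.
apply: le_trans (le_measure P _ _ cover) _; rewrite ?inE.
- exact: mE.
- exact: bigsetU_measurable.
apply: le_trans (measure_bigsetU_le_card mev ev_le) _.
by rewrite card_bool lee_fin le_eqVlt; apply/orP; left; apply/eqP; ring.
Qed.
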